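(* For all $n\geq 2$, $$p^{\times}(n)\leq n\,e^{c_0\sqrt{n}},\qquad\text{where } c_0=\pi\sqrt{2/3}.$$
   Context: A sum of cycles is a finite digraph that is a disjoint union of directed cycles, considered up to isomorphism; $|A|$ is the number of vertices of $A$. The product $AB$ is the direct product of digraphs, i.e. the distributive product (over disjoint union) with $C_aC_b=\gcd(a,b)\,C_{\operatorname{lcm}(a,b)}$, where $C_\ell$ is the directed cycle of length $\ell$ and $nC_\ell$ denotes $n$ disjoint copies of it. For $n\ge 2$, $P^{\times}(n)$ is the set of finite sequences of sums of cycles $(A_1,A_2,\dots,A_k)$ such that $2\leq |A_1|\leq |A_2|\leq \cdots \leq |A_k|$ and $|A_1A_2\cdots A_k|=n$, and $p^{\times}(n)=|P^{\times}(n)|$. *)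

(* Defs.v *)
(* MathComp with MathComp-Analysis. *)
From mathcomp Require Import all_boot all_order all_algebra.
From mathcomp Require Import generic_quotient finmap.
From mathcomp Require Import all_classical all_reals all_analysis.

Set Implicit Arguments.
Unset Strict Implicit.
Unset Printing Implicit Defensive.

Local Open Scope classical_set_scope.
Local Open Scope quotient_scope.

(* A finite digraph, loops allowed, on the vertex set {0, ..., m - 1}. Fixing
   the vertex sets makes digraphs a small type; the constructions below
   are made on an arbitrary vertex type and renumbered by [digraph_of]. *)
Definition digraph := {m : nat & {ffun 'I_m * 'I_m -> bool}}.

Definition order_digraph (G : digraph) : nat := tag G.

Definition vertex (G : digraph) := 'I_(order_digraph G).

Definition edge (G : digraph) : rel (vertex G) := fun u v => tagged G (u, v).
Arguments edge : clear implicits.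

Definition digraph_of (T : finType) (e : rel T) : digraph :=
  Tagged (fun m => {ffun 'I_m * 'I_m -> bool})
    [ffun p : 'I_#|T| * 'I_#|T| => e (enum_val p.1) (enum_val p.2)].

Definition digraph_iso (G H : digraph) : bool :=
  `[< exists f : vertex G -> vertex H,
      bijective f /\ forall u v, edge H (f u) (f v) = edge G u v >].

(* The loop for l = 1. *)
Definition dicycle (l : nat) : digraph :=
  digraph_of (fun i j : 'I_l => (j : nat) == i.+1 %% l).

Definition empty_digraph : digraph := digraph_of (fun _ _ : 'I_0 => false).

Definition disjoint_union (G H : digraph) : digraph :=
  digraph_of (fun x y : vertex G + vertex H =>
    match x, y with
    | inl u, inl v => edge G u v
    | inr u, inr v => edge H u v
    | _, _ => false
    end).

Definition direct_product (G H : digraph) : digraph :=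
  digraph_of (fun x y : vertex G * vertex H =>
    edge G x.1 y.1 && edge H x.2 y.2).

Lemma digraph_iso_refl : reflexive digraph_iso.
Proof. by move=> G; apply/asboolP; exists id; split=> //; exists id. Qed.

Lemma digraph_iso_sym : symmetric digraph_iso.
Proof.
suff iso_sym G H : digraph_iso G H -> digraph_iso H G.
  by move=> G H; apply/idP/idP; apply: iso_sym.
move=> /asboolP[f [[g fK gK] fE]]; apply/asboolP; exists g; split.
  by exists f.
by move=> u v; rewrite -fE !gK.
Qed.

Lemma digraph_iso_trans : transitive digraph_iso.
Proof.
move=> H G K /asboolP[f [fbij fE]] /asboolP[g [gbij gE]].
apply/asboolP; exists (g \o f); split; first exact: bij_comp.
by move=> u v; rewrite /= gE fE.
Qed.

Canonical digraph_iso_equiv :=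
  EquivRel digraph_iso digraph_iso_refl digraph_iso_sym digraph_iso_trans.

Definition digraph_class := {eq_quot digraph_iso}.

Definition class_of (G : digraph) : digraph_class := \pi_digraph_class G.

Lemma class_ofP (G H : digraph) :
  reflect (class_of G = class_of H) (digraph_iso G H).
Proof. by apply: (iffP idP) => [h|/eqmodP //]; apply/eqmodP. Qed.

(* |A| *)
Definition class_order (A : digraph_class) : nat := order_digraph (repr A).

(* The product of isomorphism classes induced by the direct product. *)
Definition class_prod (A B : digraph_class) : digraph_class :=
  class_of (direct_product (repr A) (repr B)).

Lemma repr_class_of (G : digraph) : digraph_iso (repr (class_of G)) G.
Proof. by apply/class_ofP; rewrite /class_of reprK. Qed.

Lemma class_orderE (G : digraph) : class_order (class_of G) = order_digraph G.
Proof.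
have /asboolP[f [fbij _]] := repr_class_of G.
by have := bij_eq_card fbij; rewrite !card_ord.
Qed.

Lemma digraph_of_iso (S T : finType) (d : rel S) (e : rel T) (f : S -> T) :
  bijective f -> (forall x y, e (f x) (f y) = d x y) ->
  digraph_iso (digraph_of d) (digraph_of e).
Proof.
move=> [g fK gK] fE; apply/asboolP.
exists (fun i : 'I_#|S| => enum_rank (f (enum_val i)) : 'I_#|T|); split.
  exists (fun i : 'I_#|T| => enum_rank (g (enum_val i)) : 'I_#|S|).
    by move=> i; rewrite enum_rankK fK enum_valK.
  by move=> i; rewrite enum_rankK gK enum_valK.
by move=> u v; rewrite /edge /= !ffunE /= !enum_rankK fE.
Qed.

Lemma class_prodE (G H : digraph) :
  class_prod (class_of G) (class_of H) = class_of (direct_product G H).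
Proof.
apply/class_ofP.
have /asboolP[f [[f' fK f'K] fE]] := repr_class_of G.
have /asboolP[g [[g' gK g'K] gE]] := repr_class_of H.
apply: (@digraph_of_iso _ _ _ _ (fun x => (f x.1, g x.2))).
  exists (fun x => (f' x.1, g' x.2)) => -[x y] /=.
    by rewrite fK gK.
  by rewrite f'K g'K.
by move=> x y /=; rewrite fE gE.
Qed.

(* A sum of cycles, up to isomorphism; [s] lists the lengths of the cycles. *)
Definition sum_of_cycles (A : digraph_class) : Prop :=
  exists2 s : seq nat, all (fun l => 0 < l) s &
    A = class_of (\big[disjoint_union/empty_digraph]_(l <- s) dicycle l).

(* The path condition reads 2 <= |A_1| <= ... <= |A_k|. The neutral element
   [class_of (dicycle 1)] is the value of the empty product; it has order 1, so
   the empty sequence is excluded for n >= 2. *)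
Definition Ptimes (n : nat) : set (seq digraph_class) :=
  [set As | [/\ forall A, A \in As -> sum_of_cycles A,
                path leq 2 [seq class_order A | A <- As] &
                class_order (\big[class_prod/class_of (dicycle 1)]_(A <- As) A) = n]].

(* [fset_set] is empty on an infinite set, so this is the cardinality of
   [Ptimes n] only when that set is finite. *)
Definition ptimes (n : nat) : nat := #|` fset_set (Ptimes n)|%fset.

(* Main.v *)
Require Import Defs.
From mathcomp Require Import all_boot all_order all_algebra.
From mathcomp Require Import finmap zify lra.
From mathcomp Require Import all_classical all_reals all_analysis.
Import Order.TTheory GRing.Theory Num.Theory.
Import numFieldNormedType.Exports.

(** Write p(m) for the number of partitions of m and E(m) = exp (c0 sqrt m).
    A sum of cycles with m vertices is determined by the multiset of its cycle
    lengths, so there are at most p(m) of them ([mem_sums_of_cycles]), and the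
    order is multiplicative.

    An element of P(n) is either a single sum of cycles of order n, or has a
    first factor of some order a followed by an element of P(b) with ab = n;
    as the orders increase, 2 <= a <= b ([Ptimes_cons]). Hence the sizes t(n)
    of the lists [factorizations n n], which enumerate P(n), satisfy
    t(n) <= p(n) + sum p(a) t(b). By induction t(b) <= b E(b), and
    b p(a) E(b) <= 2 E(ab): the gap between sqrt b and sqrt (ab) is wide enough
    for the crude bound p(a) <= 2 ^ (a - 1) to suffice ([pow2_mul_le_expR]).
    Since a <= n / 2, there are at most n / 2 - 1 values of a, whence
    t(n) <= E(n) + (n / 2 - 1) 2 E(n) <= n E(n) ([size_factorizations_le]).

    The sharp constant c0 is used for the single factors only, through
    p(n) <= E(n) ([npartitions_le_expR]). This is the argument of Erdos:
    differentiating the generating function of the partitions logarithmically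
    gives n p(n) = sum_v sum_k v p(n - kv) ([npartitions_recurrence]); inserting
    the bound for smaller arguments, linearising the square root, and summing
    over v leaves 4 n / c0 ^ 2 times the sum of 1 / k ^ 2, which is at most n
    exactly because c0 ^ 2 = 4 pi ^ 2 / 6.

    Euler's bound on the sum of 1 / k ^ 2 ([sum_inv_sqr_le]) comes from halving
    angles: 1 / sin ^ 2 at x / 2 and at (pi - x) / 2 add up to 4 / sin ^ 2 x, so
    iterating from pi / 4 evaluates the sum of 1 / sin ^ 2 over the odd
    multiples of pi / 2 ^ (k + 2) in (0, pi / 2), and sin x <= x compares it with
    the sum of the inverse squares of the odd numbers. *)

Set Implicit Arguments.
Unset Strict Implicit.
Unset Printing Implicit Defensive.

(** * Partitions *)

(** The partitions of [n] into parts at most [K], split according to whether the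
    largest possible part [K] occurs. The inner recursion, on [n], is for the
    partitions in which it does. *)
Fixpoint partitions (K : nat) : nat -> seq (seq nat) :=
  if K is K'.+1 then
    fix partitionsK n :=
      if n is n'.+1 then
        partitions K' n ++
        (if K' <= n' then [seq K :: t | t <- partitionsK (n' - K')] else [::])
      else [:: [::]]
  else fun n => if n is _.+1 then [::] else [:: [::]].

Definition npartitions K n := size (partitions K n).

Lemma npartitionsn0 K : npartitions K 0 = 1.
Proof. by case: K. Qed.

Lemma npartitionsS K n :
  npartitions K.+1 n =
  npartitions K n + (if K < n then npartitions K.+1 (n - K.+1) else 0).
Proof.
case: n => [|n]; first by rewrite !npartitionsn0.
rewrite {1}/npartitions /= size_cat ltnS subSS.
by case: (K <= n); rewrite ?size_map.
Qed.

(** The extra summand 2 ^ (n - K) makes the induction on [K] exact: allowing the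
    part [K.+1] adds at most 2 ^ (n - K.+1) partitions of [n.+1] if K < n, and one
    if K = n, which is what the summand loses. *)
Lemma npartitions_pow2 K n :
  npartitions K n.+1 + (if K <= n then 2 ^ (n - K) else 0) <= 2 ^ n.
Proof.
elim/ltn_ind: n K => n IHn; elim=> [|K IHK]; first by rewrite subn0.
rewrite npartitionsS ltnS subSS; move: IHK; case: (leqP K n) => [leKn|ltnK].
  case def_m: (n - K) => [|m].
    by rewrite npartitionsn0 (_ : K < n = false) ?addn0 //; lia.
  have := IHn m ltac:(lia) K.+1; rewrite (_ : K < n); last by lia.
  have -> : n - K.+1 = m by lia.
  by rewrite expnS; case: ifP; lia.
by rewrite (_ : K < n = false) ?addn0 //; lia.
Qed.

(** The number of partitions of the integer n - m, which is zero when that is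
    negative: truncated subtraction would count the empty partition instead. *)
Definition npartitions_sub K n m := if m <= n then npartitions K (n - m) else 0.

Lemma npartitions_subS K n m :
  npartitions_sub K.+1 n m =
  npartitions_sub K n m + npartitions_sub K.+1 n (m + K.+1).
Proof.
rewrite /npartitions_sub; case: (leqP m n) => [lemn|ltnm].
  rewrite npartitionsS subnDA; congr (_ + _).
  by rewrite (_ : m + K.+1 <= n = (K < n - m)) //; lia.
by rewrite ifF //; lia.
Qed.

Lemma npartitions_subB K n d m : d <= n ->
  npartitions_sub K (n - d) m = npartitions_sub K n (m + d).
Proof.
move=> ledn; rewrite /npartitions_sub addnC subnDA.
by rewrite (_ : d + m <= n = (m <= n - d)) //; lia.
Qed.

(** Both sides count the partitions of [n] weighted by their sum: the term of [v]
    and [k] collects the partitions in which the part [v.+1] occurs at least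
    [k.+1] times, each with weight [v.+1]. The proof is an induction along
    [npartitionsS]. The bound [M] is kept apart from [n] so that the
    range of [k] stays the same when [n] decreases; the terms with
    [k.+1 * v.+1 > n] vanish. *)
Lemma npartitions_recurrence M K n : n <= M ->
  n * npartitions K n =
  \sum_(v < K) \sum_(k < M) v.+1 * npartitions_sub K n (k.+1 * v.+1).
Proof.
elim: K n => [|K IHK] n leqnM.
  by rewrite big_ord0; case: n {leqnM} => // n; apply: muln0.
elim/ltn_ind: n leqnM => n IHn leqnM.
have -> : npartitions K.+1 n = npartitions K n + npartitions_sub K.+1 n K.+1.
  by have := npartitions_subS K n 0; rewrite /npartitions_sub /= !subn0.
rewrite mulnDr IHK //.
(* Of the weight n of a partition containing K.+1, the removed part carries
   K.+1, and the rest is the statement for n - K.+1. *)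
have -> : n * npartitions_sub K.+1 n K.+1 =
    K.+1 * npartitions_sub K.+1 n K.+1 +
    \sum_(v < K.+1) \sum_(k < M)
      v.+1 * npartitions_sub K.+1 n (k.+1 * v.+1 + K.+1).
  rewrite {1 2}/npartitions_sub; case: (ltnP K n) => ltKn; last first.
    rewrite !muln0 big1 // => v _; rewrite big1 // => k _.
    by rewrite /npartitions_sub ifF ?muln0 //; lia.
  under eq_bigr do under eq_bigr do rewrite -npartitions_subB //.
  by rewrite -IHn -?mulnDl ?subnKC //; lia.
rewrite !big_ord_recr /= [X in _ + X = _]addnCA addnA; congr (_ + _).
  rewrite -big_split /=; apply: eq_bigr => v _.
  rewrite -big_split /=; apply: eq_bigr => k _.
  by rewrite [in RHS]npartitions_subS mulnDr.
(* For the part K.+1 itself the shift moves the index k by one; the last term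
   falls outside the range. *)
case: M leqnM {IHK IHn} => [|M] leqnM.
  by rewrite !big_ord0 addn0 /npartitions_sub ifF ?muln0 //; lia.
rewrite big_ord_recr [RHS]big_ord_recl /= mul1n.
rewrite [X in _ + (_ + X)](_ : _ = 0) ?addn0; last first.
  by rewrite /npartitions_sub ifF ?muln0 //; lia.
congr (_ + _); apply: eq_bigr => k _.
by rewrite /bump /= add1n [k.+2 * _]mulSn addnC.
Qed.

(** * Sums of cycles as partitions *)

Lemma order_disjoint_union G H :
  order_digraph (disjoint_union G H) = order_digraph G + order_digraph H.
Proof. by rewrite /order_digraph /= card_sum !card_ord. Qed.

Lemma order_direct_product G H :
  order_digraph (direct_product G H) = order_digraph G * order_digraph H.
Proof. by rewrite /order_digraph /= card_prod !card_ord. Qed.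

Lemma order_dicycle l : order_digraph (dicycle l) = l.
Proof. by rewrite /order_digraph /= card_ord. Qed.

Lemma class_order_prod A B :
  class_order (class_prod A B) = class_order A * class_order B.
Proof. by rewrite class_orderE order_direct_product. Qed.

Definition class_prods (As : seq digraph_class) :=
  \big[class_prod/class_of (dicycle 1)]_(A <- As) A.

Lemma class_order_prods As :
  class_order (class_prods As) = \prod_(A <- As) class_order A.
Proof.
rewrite /class_prods; elim: As => [|A As IH].
  by rewrite !big_nil class_orderE order_dicycle.
by rewrite !big_cons class_order_prod IH.
Qed.

Lemma edge_digraph_of (T : finType) (e : rel T) (u v : 'I_#|T|) :
  edge (digraph_of e) u v = e (enum_val u) (enum_val v).
Proof. by rewrite /edge /= ffunE. Qed.

Lemma disjoint_union_iso G H H' : digraph_iso H H' ->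
  digraph_iso (disjoint_union G H) (disjoint_union G H').
Proof.
move=> /asboolP[f [[g fK gK] fE]].
pose lift (X Y : digraph) (h : vertex X -> vertex Y)
  (z : vertex G + vertex X) : vertex G + vertex Y :=
  match z with inl u => inl u | inr v => inr (h v) end.
apply: (@digraph_of_iso _ _ _ _ (@lift _ _ f)).
  by exists (@lift _ _ g) => -[u|v] //=; rewrite ?fK ?gK.
by move=> [u|v] [u'|v'] //=; rewrite fE.
Qed.

Lemma disjoint_unionCA G H K :
  digraph_iso (disjoint_union G (disjoint_union H K))
              (disjoint_union H (disjoint_union G K)).
Proof.
pose swap (X Y : digraph) (z : vertex X + vertex (disjoint_union Y K)) :
    vertex Y + vertex (disjoint_union X K) :=
  match z with
  | inl x => inr (enum_rank (inl x : vertex X + vertex K))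
  | inr i => match enum_val i with
             | inl y => inl y
             | inr k => inr (enum_rank (inr k : vertex X + vertex K))
             end
  end.
have swapK X Y : cancel (@swap X Y) (@swap Y X).
  move=> [x|i] /=; first by rewrite enum_rankK.
  case def_i: (enum_val i) => [y|k] /=; last rewrite enum_rankK.
    by rewrite -def_i enum_valK.
  by rewrite -def_i enum_valK.
apply: (@digraph_of_iso _ _ _ _ (@swap G H)); first by exists (@swap H G).
move=> [x|i] [x'|i'] /=.
- by rewrite edge_digraph_of !enum_rankK.
- case def_i': (enum_val i') => [y'|k'] //=.
  by rewrite edge_digraph_of !enum_rankK.
- case def_i: (enum_val i) => [y|k] //=.
  by rewrite edge_digraph_of !enum_rankK.
rewrite edge_digraph_of.
case def_i: (enum_val i) => [y|k] /=; case def_i': (enum_val i') => [y'|k'] //=.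
by rewrite edge_digraph_of !enum_rankK.
Qed.

Definition cycle_sum (s : seq nat) :=
  \big[disjoint_union/empty_digraph]_(l <- s) dicycle l.

Lemma order_cycle_sum s : order_digraph (cycle_sum s) = sumn s.
Proof.
rewrite /cycle_sum; elim: s => [|l s IH] /=.
  by rewrite big_nil /order_digraph /= card_ord.
by rewrite big_cons order_disjoint_union order_dicycle IH.
Qed.

Lemma cycle_sum_rem l s : l \in s ->
  digraph_iso (cycle_sum s) (cycle_sum (l :: rem l s)).
Proof.
elim: s => // l' s IH; rewrite in_cons /=.
case: (l' =P l) => [->|ne_l'l] /=; first by move=> _; apply: digraph_iso_refl.
rewrite eq_sym; case: eqP => //= _ /IH iso_s.
rewrite /cycle_sum !big_cons; apply: digraph_iso_trans (disjoint_unionCA _ _ _).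
by apply: disjoint_union_iso; move: iso_s; rewrite /cycle_sum big_cons.
Qed.

(** Pulling the cycles of the largest allowed length to the front, one at a time,
    sorts the lengths along the recursion that defines [partitions]. *)
Lemma cycle_sum_partition K n s :
  all (fun l => 0 < l <= K) s -> sumn s = n ->
  exists2 t, t \in partitions K n & digraph_iso (cycle_sum s) (cycle_sum t).
Proof.
elim: K n s => [|K IHK] n s.
  case: s => [_ <-|l s /= /andP[]]; last by lia.
  by exists [::] => //; apply: digraph_iso_refl.
elim/ltn_ind: n s => -[|n] IHn s s_bnd sum_s.
  case: s s_bnd sum_s => [|l s /= /andP[]]; last by lia.
  by exists [::] => //; apply: digraph_iso_refl.
have [Ks|nKs] := boolP (K.+1 \in s).
  have perm_s := perm_to_rem Ks.
  have sum_rem : K.+1 + sumn (rem K.+1 s) = n.+1.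
    by rewrite -sum_s (perm_sumn perm_s).
  have [|t t_in iso_t] := IHn (n - K) ltac:(lia) (rem K.+1 s) _ ltac:(lia).
    by move: s_bnd; rewrite (perm_all _ perm_s) /= => /andP[].
  exists (K.+1 :: t).
    rewrite /= mem_cat ifT; last by lia.
    by rewrite map_f ?orbT.
  apply: digraph_iso_trans (cycle_sum_rem Ks) _.
  by rewrite /cycle_sum !big_cons; apply: disjoint_union_iso.
have [|t t_in iso_t] := IHK n.+1 s _ sum_s.
  apply/allP => l ls; have := allP s_bnd _ ls.
  by case: (l =P K.+1) => [def_l|]; [rewrite -def_l ls in nKs|lia].
by exists t => //; rewrite /= mem_cat t_in.
Qed.

Definition sums_of_cycles n :=
  [seq class_of (cycle_sum t) | t <- partitions n n].

Lemma mem_sums_of_cycles A :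
  sum_of_cycles A -> A \in sums_of_cycles (class_order A).
Proof.
move=> [s s_gt0 ->]; rewrite -/(cycle_sum s) class_orderE order_cycle_sum.
have [|t t_in /class_ofP ->] := @cycle_sum_partition (sumn s) _ s _ erefl.
  apply/allP => l ls; rewrite (allP s_gt0 _ ls) /=.
  by rewrite (perm_sumn (perm_to_rem ls)) /= leq_addr.
exact: map_f.
Qed.

(** * Enumeration of the factorizations *)

(** The orders a that the first of at least two factors can have: the product
    of the others has order n / a, which is at least a and at least 2. *)
Definition first_factors n :=
  [seq a <- iota 2 n./2.-1 | (a %| n) && (a ^ 2 <= n)].

(** An enumeration of P(n), possibly with other sequences; [d] only bounds the
    depth of the recursion. *)
Fixpoint factorizations (d n : nat) : seq (seq digraph_class) :=
  if d is d'.+1 then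
    [seq [:: A] | A <- sums_of_cycles n] ++
    flatten
      [seq [seq A :: As | A <- sums_of_cycles a,
                          As <- factorizations d' (n %/ a)]
      | a <- first_factors n]
  else [::].

Lemma Ptimes_cons n A As : 2 <= n -> Ptimes n (A :: As) ->
  let a := class_order A in
  sum_of_cycles A /\
  (As = [::] /\ a = n \/ [/\ a \in first_factors n & Ptimes (n %/ a) As]).
Proof.
move=> n_ge2 [cycles /= /andP[a_ge2 sorted_As]].
rewrite -/(class_prods _) class_order_prods big_cons -class_order_prods.
set a := class_order A in a_ge2 sorted_As *; set b := class_order _ => def_n.
split; first by apply: cycles; apply: mem_head.
case: As => [|A2 As] in cycles sorted_As b def_n *.
  by left; split=> //; rewrite -def_n /b class_order_prods big_nil muln1.
right; have def_b : n %/ a = b by rewrite -def_n mulKn //; lia.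
(* The product is at least its first factor, the others being nonempty. *)
have leab : a <= b.
  move: sorted_As => /= /andP[le_a2 sorted_As].
  rewrite /b class_order_prods big_cons (leq_trans le_a2) // leq_pmulr //.
  rewrite big_seq; elim/big_ind: _ => [//|x y x0 y0|A' As'].
    by rewrite muln_gt0 x0.
  apply: leq_trans (_ : class_order A2 <= _); first lia.
  have /order_path_min /allP := sorted_As.
  by apply => //; [exact: leq_trans|exact: map_f].
split.
  rewrite mem_filter mem_iota -def_n dvdn_mulr //= expnS expn1 leq_mul2l leab.
  by rewrite orbT /=; nia.
split; rewrite ?def_b //.
  by move=> B BAs; apply: cycles; rewrite in_cons BAs orbT.
by move: sorted_As => /= /andP[le_a2 ->]; rewrite andbT (leq_trans a_ge2).
Qed.

Lemma mem_factorizations d n As :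
  2 <= n <= d -> Ptimes n As -> As \in factorizations d n.
Proof.
elim: d n As => [|d IHd] n As /andP[n_ge2 lend]; first lia.
case: As => [|A As].
  by move=> [_ _]; rewrite big_nil class_orderE order_dicycle; lia.
move=> /(Ptimes_cons n_ge2)[/mem_sums_of_cycles A_in]; rewrite /= mem_cat.
move=> [[-> def_a]|[a_in As_in]].
  by rewrite -def_a (map_f (fun A => [:: A])).
apply/orP; right; apply/flatten_mapP; exists (class_order A) => //.
apply/allpairs_f => //; apply: IHd => //.
move: a_in; rewrite mem_filter mem_iota.
move=> /andP[/andP[/dvdnP[b def_n] le_a2n] /andP[a_ge2 _]].
move: le_a2n lend; rewrite def_n expnS expn1 leq_mul2r mulnK; last lia.
nia.
Qed.

Local Open Scope ring_scope.

(** * The sum of the inverse squares *)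

Lemma sin_le_id (R : realType) (x : R) : 0 <= x -> sin x <= x.
Proof.
move=> x_ge0.
have [|c _] := MVT_segment x_ge0 (fun y _ => is_derive_sin y).
  by apply: derivable_within_continuous => y _; apply: ex_derive.
rewrite sin0 !subr0 => ->.
by rewrite ler_piMl // cos_le1.
Qed.

(** As (pi - x) / 2 is complementary to x / 2, the left-hand side is
    1 / (sin ^ 2 cos ^ 2) at x / 2, and sin x = 2 sin (x / 2) cos (x / 2). *)
Lemma sin_half_addV2 (R : realType) (x : R) : 0 < x < pi ->
  sin (x / 2) ^- 2 + sin ((pi - x) / 2) ^- 2 = 4 * sin x ^- 2.
Proof.
move=> /andP[x_gt0 x_lt_pi].
have -> : sin ((pi - x) / 2) = cos (x / 2).
  have -> : (pi - x) / 2 = pi / 2 - x / 2 by lra.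
  by rewrite sinB sin_pihalf cos_pihalf; lra.
have sx_gt0 : 0 < sin (x / 2) by apply: sin_gt0_pihalf; lra.
have cx_gt0 : 0 < cos (x / 2) by apply: cos_gt0_pihalf; lra.
have -> : sin x = 2 * (cos (x / 2) * sin (x / 2)).
  by rewrite mulr_natl -sin_mulr2n; congr sin; lra.
have := cos2Dsin2 (x / 2).
move: (sin _) (cos _) sx_gt0 cx_gt0 => u v u_gt0 v_gt0 uv1.
have -> : 4 = 2 ^+ 2 :> R by rewrite -natrX.
rewrite !exprMn [in RHS]invfM mulrA divff ?expf_neq0 ?pnatr_eq0 // mul1r.
rewrite -[RHS]mul1r -uv1 [in RHS]invfM mulrDl mulVKf ?expf_neq0 ?gt_eqF //.
by rewrite [X in _ = _ + X]mulrCA divff ?mulr1 ?expf_neq0 ?gt_eqF.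
Qed.

(** For j < 2 ^ k these are the odd multiples of pi / 2 ^ (k + 2) below pi / 2;
    those of rank k + 1 are the x / 2 and the (pi - x) / 2 for the x of rank k. *)
Definition odd_angle {R : realType} (k j : nat) : R :=
  (2 * j%:R + 1) * (pi / 2 ^+ k.+2).

Lemma odd_angle_bound (R : realType) k j : (j < 2 ^ k)%N ->
  0 < @odd_angle R k j < (pi : R) / 2.
Proof.
move=> ltj; have pi_gt0 := pi_gt0 R.
have h_gt0 : 0 < pi / 2 ^+ k.+2 :> R by rewrite divr_gt0 // exprn_gt0.
have w_gt0 : 0 < 2 * j%:R + 1 :> R by rewrite ltr_wpDl // mulr_ge0.
rewrite /odd_angle mulr_gt0 //=.
have -> : pi / 2 = 2 ^+ k.+1 * (pi / 2 ^+ k.+2) :> R.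
  by rewrite [2 ^+ k.+2]exprSr invfM mulrCA mulVKf ?expf_neq0.
rewrite ltr_pM2r // -natrM -natrX natr1 ltr_nat expnS; lia.
Qed.

Lemma sum_sin_odd_angleV2 (R : realType) k :
  \sum_(j < 2 ^ k) sin (@odd_angle R k j) ^- 2 = 2 * 4 ^+ k.
Proof.
elim: k => [|k IH].
  rewrite expn0 big_ord_recl big_ord0 /odd_angle mulr0 add0r mul1r expr0 addr0.
  have := @sin_half_addV2 R (pi / 2) _.
  have -> : (pi - pi / 2) / 2 = pi / 2 / 2 :> R by lra.
  have -> : pi / 2 ^+ 2 = pi / 2 / 2 :> R by lra.
  rewrite sin_pihalf expr1n invr1 => /(_ ltac:(have := pi_gt0 R; lra)).
  lra.
have -> : (2 ^ k.+1 = 2 ^ k + 2 ^ k)%N by rewrite expnS mul2n addnn.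
(* The upper half of the angles is listed backwards, because (pi - x) / 2
   decreases when x increases. *)
rewrite big_split_ord /= [X in _ + X](reindex_inj rev_ord_inj) -big_split /=.
rewrite exprS mulrCA -IH mulr_sumr; apply: eq_bigr => j _.
rewrite -sin_half_addV2; last first.
  by have := odd_angle_bound R (ltn_ord j); have := pi_gt0 R; lra.
have half_angle : pi / 2 ^+ k.+3 = pi / 2 ^+ k.+2 / 2 :> R.
  by rewrite [2 ^+ k.+3]exprSr invfM !mulrA.
congr (sin _ ^- 2 + sin _ ^- 2); first by rewrite /odd_angle half_angle mulrA.
rewrite /odd_angle half_angle.
rewrite -[X in (X - _) / 2](@divfK _ (2 ^+ k.+2)) ?expf_neq0 //.
rewrite natrD natrB // -natr1 natrX !exprS; lra.
Qed.

Lemma sum_odd_inv_sqr_le (R : realType) M :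
  \sum_(j < M) (2 * j%:R + 1) ^- 2 <= (pi : R) ^+ 2 / 8.
Proof.
have leM2 : (M <= 2 ^ M)%N by rewrite ltnW // ltn_expl.
apply: (@le_trans _ _ (\sum_(j < 2 ^ M) (2 * j%:R + 1) ^- 2)).
  rewrite -(subnKC leM2) big_split_ord /= lerDl; apply: sumr_ge0 => j _.
  by rewrite invr_ge0 sqr_ge0.
pose h : R := pi / 2 ^+ M.+2.
apply: (@le_trans _ _ (h ^+ 2 * \sum_(j < 2 ^ M) sin (@odd_angle R M j) ^- 2)).
  rewrite mulr_sumr; apply: ler_sum => j _.
  have /andP[angle_gt0 angle_lt] := odd_angle_bound R (ltn_ord j).
  have sin_gt0 : 0 < sin (@odd_angle R M j) by apply: sin_gt0_pihalf; lra.
  have w_gt0 : 0 < 2 * j%:R + 1 :> R by rewrite ltr_wpDl // mulr_ge0.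
  rewrite ler_pdivlMr ?exprn_gt0 // ler_pdivrMl ?exprn_gt0 // -exprMn.
  by rewrite ler_sqr ?nnegrE ?(ltW sin_gt0) ?(ltW angle_gt0) ?sin_le_id // ltW.
have -> : h ^+ 2 = pi ^+ 2 / (16 * 4 ^+ M).
  rewrite /h expr_div_n -!natrX -natrM; congr (_ / _%:R).
  by rewrite -expnM mulnC expnM !expnS mulnA.
rewrite sum_sin_odd_angleV2 invfM -!mulrA [_^-1 * (2 * _)]mulrCA.
rewrite mulVf ?expf_neq0 ?pnatr_eq0 //.
lra.
Qed.

Lemma sum_inv_sqr_le (R : realType) M :
  \sum_(k < M) k.+1%:R ^- 2 <= (pi : R) ^+ 2 / 6.
Proof.
(* The even numbers up to 2 M contribute a quarter of the sum up to M, so three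
   quarters of it are bounded by the sum over the odd numbers. *)
pose A m : R := \sum_(k < m) k.+1%:R ^- 2.
have A_double m : A m.*2 = \sum_(j < m) (2 * j%:R + 1) ^- 2 + A m / 4.
  rewrite /A mulr_suml -big_split /=.
  elim: m => [|m IH]; first by rewrite !big_ord0.
  rewrite doubleS !big_ord_recr /= IH -addrA; congr (_ + (_ ^- 2 + _)).
    by rewrite -natr1 -mul2n natrM.
  by rewrite -doubleS -mul2n natrM exprMn invfM -(natrX _ 2 2) mulrC.
have : A M <= A M.*2.
  rewrite -addnn /A big_split_ord /= lerDl; apply: sumr_ge0 => j _.
  by rewrite invr_ge0 sqr_ge0.
rewrite A_double -/(A M); have := sum_odd_inv_sqr_le R M; lra.
Qed.

(** * The exponential bound on the number of partitions *)

Lemma double_le_sinh (R : realType) (x : R) :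
  0 <= x -> 2 * x <= expR x - expR (- x).
Proof.
move=> x_ge0.
pose f (y : R) := expR y - expR (- y) - 2 * y.
have df (y : R) : is_derive y (1 : R) f (expR y + expR (- y) - 2).
  rewrite /f; apply: is_derive_eq.
  by rewrite /GRing.scale /=; lra.
have [|c _] := MVT_segment x_ge0 (fun y _ => df y).
  apply: derivable_within_continuous => y _.
  by apply: ex_derive.
rewrite {1 2}/f oppr0 expR0 addr0 => fx.
have : 0 <= (expR c + expR (- c) - 2) * x.
  by rewrite mulr_ge0 //; have := expR_ge1Dx c; have := expR_ge1Dx (- c); lra.
lra.
Qed.

Lemma sum_mul_geometric_le (R : realType) (q : R) K : 0 <= q -> q < 1 ->
  \sum_(v < K) v.+1%:R * q ^+ v.+1 <= q / (1 - q) ^+ 2.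
Proof.
move=> q_ge0 q_lt1; rewrite ler_pdivlMr ?exprn_gt0 ?subr_gt0 //.
(* The closed form of the finite sum; what is subtracted is nonnegative. *)
suff -> : (\sum_(v < K) v.+1%:R * q ^+ v.+1) * (1 - q) ^+ 2 =
    q - q ^+ K.+1 * (1 + K%:R * (1 - q)).
  have := mulr_ge0 (exprn_ge0 K.+1 q_ge0) (_ : 0 <= 1 + K%:R * (1 - q)).
  have : 0 <= K%:R * (1 - q) by rewrite mulr_ge0 // subr_ge0 ltW.
  by move=> h1 h2; have := h2 ltac:(lra); lra.
elim: K => [|K IH]; first by rewrite big_ord0 expr1; lra.
rewrite big_ord_recr /= mulrDl IH -[K.+1%:R]natr1 !exprS; set z := q ^+ K; lra.
Qed.

(** The whole series has the value e^-y / (1 - e^-y) ^ 2 =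
    1 / (2 sinh (y / 2)) ^ 2, and 2 sinh (y / 2) >= y. *)
Lemma sum_mul_expR_le (R : realType) (y : R) K : 0 < y ->
  \sum_(v < K) v.+1%:R * expR (- y) ^+ v.+1 <= y ^- 2.
Proof.
move=> y_gt0; have q_lt1 : expR (- y) < 1 by rewrite expR_lt1; lra.
apply: le_trans (sum_mul_geometric_le _ (expR_ge0 _) q_lt1) _.
rewrite ler_pdivrMr ?exprn_gt0 ?subr_gt0 // ler_pdivlMl ?exprn_gt0 //.
have -> : expR (- y) = expR (- (y / 2)) ^+ 2.
  by rewrite -expRM_natl; congr expR; lra.
rewrite -exprMn ler_sqr ?nnegrE ?mulr_ge0 ?expR_ge0 ?subr_ge0 ?(ltW y_gt0) //;
  last by rewrite exprn_ile1 ?expR_ge0 // expR_le1; lra.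
have := double_le_sinh (_ : 0 <= y / 2) => /(_ ltac:(lra)) sinh_y.
have := expRxMexpNx_1 (y / 2); have := expR_gt0 (- (y / 2)).
nra.
Qed.

(** The hypothesis on [c] is what the induction consumes: by
    sqrt (n - m) <= sqrt n - m / (2 sqrt n), the recurrence bounds n p(n) by
    exp (c sqrt n) times the sum over k of (2 sqrt n / (c k)) ^ 2. *)
Lemma npartitions_le_expR (R : realType) (c : R) K n : 0 < c ->
  (forall M, \sum_(k < M) k.+1%:R ^- 2 <= c ^+ 2 / 4) ->
  (npartitions K n)%:R <= expR (c * Num.sqrt n%:R).
Proof.
move=> c_gt0 zeta_le; elim/ltn_ind: n K => -[|n] IHn K.
  by rewrite npartitionsn0 sqrtr0 mulr0 expR0.
set s := Num.sqrt _; have s_gt0 : 0 < s by rewrite sqrtr_gt0 ltr0n.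
have s2 : s ^+ 2 = n.+1%:R by rewrite sqr_sqrtr.
pose y k : R := c * k.+1%:R / (2 * s).
have y_gt0 k : 0 < y k by rewrite divr_gt0 ?mulr_gt0 // ltr0n.
have term_le m : (0 < m)%N ->
    (npartitions_sub K n.+1 m)%:R <=
      expR (c * s) * expR (- (c * m%:R / (2 * s))).
  move=> m_gt0; rewrite /npartitions_sub; case: leqP => [lemn|_]; last first.
    by rewrite mulr_ge0 ?expR_ge0.
  apply: le_trans (IHn _ _ _) _; first lia.
  rewrite -expRD ler_expR -mulrA -mulrBr ler_pM2l //.
  have arg_ge0 : 0 <= s - m%:R / (2 * s).
    rewrite subr_ge0 ler_pdivrMr ?mulr_gt0 //.
    rewrite mulrCA -expr2 s2; have : (m%:R : R) <= n.+1%:R by rewrite ler_nat.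
    by have : (0 : R) <= n.+1%:R by []; lra.
  rewrite -(ger0_norm arg_ge0) -sqrtr_sqr ler_wsqrtr // natrB // sqrrB s2.
  rewrite [s * _]mulrC invfM mulrA divfK ?gt_eqF //.
  by have := sqr_ge0 (m%:R / 2 / s); rewrite -mulr_natr; lra.
rewrite -(@ler_pM2l _ n.+1%:R) ?ltr0n // -natrM.
rewrite (npartitions_recurrence K (leqnn n.+1)) exchange_big natr_sum /=.
apply: (@le_trans _ _ (\sum_(k < n.+1) expR (c * s) * y k ^- 2)).
  apply: ler_sum => k _; rewrite natr_sum.
  apply: le_trans (ler_wpM2l (expR_ge0 _) (sum_mul_expR_le K (y_gt0 k))).
  rewrite mulr_sumr; apply: ler_sum => v _.
  rewrite natrM mulrCA ler_wpM2l // -expRM_natl.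
  apply: le_trans (term_le _ _) _; first lia.
  rewrite natrM mulrN ler_wpM2l ?expR_ge0 // /y [v.+1%:R * _]mulrC.
  by rewrite -!mulrA [v.+1%:R * _]mulrC.
rewrite -mulr_sumr mulrC ler_wpM2r ?expR_ge0 //.
have -> : \sum_(k < n.+1) y k ^- 2 =
    4 * n.+1%:R / c ^+ 2 * \sum_(k < n.+1) k.+1%:R ^- 2.
  rewrite mulr_sumr; apply: eq_bigr => k _.
  by rewrite /y expr_div_n !exprMn invf_div s2 invfM !mulrA -(natrX _ 2 2).
apply: le_trans (ler_wpM2l _ (zeta_le _)) _; first by rewrite divr_ge0 ?sqr_ge0.
rewrite mulrA divfK ?expf_neq0 ?gt_eqF //; lra.
Qed.

(** * Counting the factorizations *)

Lemma expR_ge_linear (R : realType) (y : R) : 0 <= y -> 9 / 4 * y <= expR y.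
Proof.
move=> y_ge0.
have e_ge : 9 / 4 <= expR 1 :> R.
  have -> : expR 1 = expR (1 / 2) ^+ 2 :> R.
    by rewrite -expRM_natl; congr expR; lra.
  by have := expR_ge1Dx (1 / 2 : R); nra.
have -> : expR y = expR 1 * expR (y - 1) by rewrite -expRD; congr expR; lra.
by have := expR_ge1Dx (y - 1); nra.
Qed.

(** The exponent is c sqrt b (sqrt a - 1); it is split at sqrt 2, the least value
    of sqrt a. As a - 2 = (sqrt a - sqrt 2) (sqrt a + sqrt 2) with a <= b, the
    part c sqrt b (sqrt a - sqrt 2) is at least a - 2 and pays for the power
    of 2. The part c sqrt b (sqrt 2 - 1) pays for b, by squaring
    [expR_ge_linear]. *)
Lemma pow2_mul_le_expR (R : realType) (c : R) (a b : nat) :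
  7 / 3 <= c -> (2 <= a <= b)%N ->
  2 ^+ (a - 2) * b%:R <=
    expR (c * Num.sqrt (a * b)%:R - c * Num.sqrt b%:R) :> R.
Proof.
move=> c_ge /andP[a_ge2 leab].
rewrite natrM sqrtrM //; set r : R := Num.sqrt a%:R; set s : R := Num.sqrt b%:R.
set t : R := Num.sqrt 2.
have t2 : t ^+ 2 = 2 by rewrite sqr_sqrtr.
have r2 : r ^+ 2 = a%:R by rewrite sqr_sqrtr.
have s2 : s ^+ 2 = b%:R by rewrite sqr_sqrtr.
have t_ge : 7 / 5 <= t.
  by rewrite -(@ler_sqr R) ?nnegrE ?sqrtr_ge0 // ?t2; lra.
have le_tr : t <= r by rewrite ler_wsqrtr // ler_nat.
have le_rs : r <= s by rewrite ler_wsqrtr // ler_nat.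
have -> : c * (r * s) - c * s = c * s * (r - t) + c * s * (t - 1) by lra.
rewrite expRD ler_pM ?exprn_ge0 //.
  apply: (@le_trans _ _ (expR (a - 2)%:R)).
    rewrite -[(a - 2)%:R]mulr1 expRM_natl lerXn2r ?nnegrE ?expR_ge0 //.
    by have := expR_ge1Dx (1 : R); lra.
  rewrite ler_expR natrB // -r2 -t2 subr_sqr [_ * (_ + _)]mulrC.
  apply: ler_wpM2r; first by rewrite subr_ge0.
  nra.
(* 14 / 15 = 7 / 3 (7 / 5 - 1) bounds c (sqrt 2 - 1) from below, and half of it
   still has 9 / 4 * 7 / 15 >= 1. *)
rewrite -s2; apply: (@le_trans _ _ (expR (7 / 15 * s) ^+ 2)).
  rewrite ler_sqr ?nnegrE ?expR_ge0 ?sqrtr_ge0 //.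
  by apply: le_trans (expR_ge_linear _); lra.
have slope_ge : 14 / 15 <= c * (t - 1) by nra.
have : 0 <= (c * (t - 1) - 14 / 15) * s.
  by rewrite mulr_ge0 ?sqrtr_ge0 ?subr_ge0.
rewrite -expRM_natl ler_expR; lra.
Qed.

Lemma size_factorizationsS d n :
  size (factorizations d.+1 n) =
  (npartitions n n + \sum_(a <- first_factors n)
     npartitions a a * size (factorizations d (n %/ a)))%N.
Proof.
rewrite /= size_cat size_map size_map size_flatten /shape -map_comp sumnE.
rewrite big_map.
by congr (_ + _)%N; apply: eq_bigr => a _; rewrite /= size_allpairs size_map.
Qed.

Lemma size_factorizations_le (R : realType) (c : R) d n :
  7 / 3 <= c -> (forall M, \sum_(k < M) k.+1%:R ^- 2 <= c ^+ 2 / 4) ->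
  (1 < n)%N ->
  (size (factorizations d n))%:R <= n%:R * expR (c * Num.sqrt n%:R) :> R.
Proof.
move=> c_ge zeta_le; have c_gt0 : 0 < c by lra.
pose E m : R := expR (c * Num.sqrt m%:R); rewrite -/(E n).
elim: d n => [|d IHd] n n_gt1; first by rewrite mulr_ge0 ?expR_ge0.
rewrite size_factorizationsS natrD natr_sum.
have term_le a : a \in first_factors n ->
    (npartitions a a * size (factorizations d (n %/ a)))%:R <= 2 * E n.
  rewrite mem_filter mem_iota.
  move=> /andP[/andP[/dvdnP[b def_n] le_a2n] /andP[a_ge2 _]].
  have leab : (a <= b)%N.
    by move: le_a2n; rewrite def_n expnS expn1 leq_mul2r; lia.
  rewrite def_n mulnK ?natrM; last lia.
  have pa_le : (npartitions a a)%:R <= 2 * 2 ^+ (a - 2) :> R.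
    rewrite -exprS -natrX ler_nat.
    case: a a_ge2 {le_a2n leab def_n} => [|[|a]] // _.
    have := npartitions_pow2 a.+2 a.+1; rewrite ltnn subn2 /=; lia.
  apply: le_trans (ler_pM _ _ pa_le (IHd b _)) _ => //; first lia.
  have := @pow2_mul_le_expR R c a b c_ge; rewrite a_ge2 leab expRB => /(_ isT).
  rewrite ler_pdivlMr ?expR_gt0 // -/(E b) mulnC -/(E (b * a)%N) => key.
  by rewrite -mulrA ler_pM2l // mulrA.
rewrite big_seq.
apply: le_trans
  (lerD (npartitions_le_expR n n c_gt0 zeta_le) (ler_sum _ term_le)) _.
rewrite -big_seq big_const_seq count_predT iter_addr_0 -/(E n) -mulrnAl.
rewrite -[_ *+ size _]mulr_natr.
have : (size (first_factors n))%:R <= (n./2.-1)%:R :> R.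
  by rewrite ler_nat size_filter (leq_trans (count_size _ _)) ?size_iota.
have : 2 * (n./2.-1)%:R + 2 <= n%:R :> R by rewrite -natrM -natrD ler_nat; lia.
have : 0 < E n by exact: expR_gt0.
nra.
Qed.

Lemma c0_sqr (R : realType) :
  (trigo.pi * Num.sqrt (2 / 3)) ^+ 2 / 4 = trigo.pi ^+ 2 / 6 :> R.
Proof. by rewrite exprMn sqr_sqrtr ?divr_ge0 //; lra. Qed.

(** The first three terms of the sum of 1 / k ^ 2 already give
    c0 ^ 2 / 4 >= 49 / 36. *)
Lemma c0_ge (R : realType) : 7 / 3 <= trigo.pi * Num.sqrt (2 / 3) :> R.
Proof.
have c0_ge0 : 0 <= trigo.pi * Num.sqrt (2 / 3) :> R.
  by rewrite mulr_ge0 ?pi_ge0 ?sqrtr_ge0.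
have := sum_inv_sqr_le R 3; rewrite -c0_sqr !big_ord_recr big_ord0 /=.
nra.
Qed.

Theorem proposition3 (R : realType) (n : nat) (hn : (2 <= n)%N) :
  finite_set (Ptimes n) /\
  (ptimes n)%:R <=
    n%:R * expR ((trigo.pi * Num.sqrt (2 / 3)) * Num.sqrt n%:R) :> R.
Proof.
have Ptimes_sub : (Ptimes n `<=` [set` factorizations n n])%classic.
  by move=> As /mem_factorizations; apply; rewrite hn leqnn.
have finP : finite_set (Ptimes n) := sub_finite_set Ptimes_sub (finite_seq _).
split=> //.
apply: le_trans (size_factorizations_le n (c0_ge R) _ hn); last first.
  by move=> M; rewrite c0_sqr sum_inv_sqr_le.
rewrite ler_nat /ptimes.
apply: (@leq_trans #|` [fset As in factorizations n n]|%fset).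
  apply: fsubset_leq_card; apply/fsubsetP => As.
  by rewrite in_fset_set // !inE => /Ptimes_sub.
by rewrite card_fseq size_undup.
Qed.
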